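(* Let $t$ be a positive integer and $G$ a finite simple graph. Let $d=\min\{\gamma_{t,1}(\vec{G})\}$ and $D=\max\{\gamma_{t,1}(\vec{G})\}$, where $\vec{G}$ ranges over all orientations of $G$. Then for every integer $b$ with $d\le b\le D$ there exists an orientation $\vec{G}_b$ of $G$ with $\gamma_{t,1}(\vec{G}_b)=b$.
   Context: An orientation $\vec{G}$ of a graph $G$ assigns to every edge $\{u,v\}$ exactly one direction. For vertices $u,v$ of $\vec{G}$, $d(u,v)$ is the minimum length of a directed path from $u$ to $v$ ($d(u,u)=0$; $\infty$ if none exists). Given positive integers $t,r$ and $S\subseteq V(\vec{G})$, the directed reception at $w$ is $\vec{r}(w)=\sum_{v\in S,\ d(v,w)<t}(t-d(v,w))$; $S$ is a directed $(t,r)$ broadcast dominating set if $\vec{r}(w)\ge r$ for every vertex $w$, and $\gamma_{t,r}(\vec{G})$ is the minimum cardinality of such a set. *)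

(* Defs.v *)
From mathcomp Require Import all_boot.

Set Implicit Arguments.
Unset Strict Implicit.
Unset Printing Implicit Defensive.

Section Broadcast.

Variable V : finType.
Implicit Types (e o : rel V) (u v w : V) (S : {set V}) (t r k : nat).

Definition orientation e o : Prop :=
  (forall u v, o u v -> e u v) /\ (forall u v, e u v -> o u v (+) o v u).

Definition dpath o u v k : bool :=
  [exists p : k.-tuple V,
     [&& path o u p, uniq (u :: p) & last u p == v]].

(* [find] returns the least length k of a directed path from u to v; only
   k < #|V| need be searched, as a path has distinct vertices.  [None] stands
   for infinite distance. *)
Definition ddist o u v : option nat :=
  let k := find (dpath o u v) (iota 0 #|V|) in
  if k < #|V| then Some k else None.

(* Subtraction is truncated, so vertices at distance at least t contribute 0. *)
Definition reception o t S w : nat :=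
  \sum_(v in S) (if ddist o v w is Some k then t - k else 0).

Definition dominating o t r S : bool :=
  [forall w, r <= reception o t S w].

(* If some set is dominating then so is [setT], hence the default of the
   [arg min] is legitimate; in particular it is so when r = 1 and t > 0. *)
Definition gamma t r o : nat :=
  #|[arg min_(S < setT | dominating o t r S) #|S|]|.

End Broadcast.

Definition is_min_over (T : Type) (P : T -> Prop) (f : T -> nat) (m : nat) :=
  (exists2 x, P x & f x = m) /\ (forall x, P x -> m <= f x).

Definition is_max_over (T : Type) (P : T -> Prop) (f : T -> nat) (m : nat) :=
  (exists2 x, P x & f x = m) /\ (forall x, P x -> f x <= m).

(* Main.v *)
Require Import Defs.
From mathcomp Require Import all_boot.

(** Reversing the arcs one at a time leads from any orientation to any other.
    Reversing u -> v raises gamma_{t,1} by at most 1: if a path of length < t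
    from S to w uses that arc, then its part after the last use of the arc is a
    surviving path of length < t from v to w, so adding v to S restores
    domination. Hence, on the way from an orientation of value d to one of
    value D, every value in between is attained. *)

Section Interpolation.

Set Implicit Arguments.
Unset Strict Implicit.
Unset Printing Implicit Defensive.

Variable V : finType.
Implicit Types (e o : rel V) (u v w : V) (S : {set V}) (t k : nat).

(** Removing cycles from a walk never lengthens it and brings its length below [#|V|], within the
    range that [ddist] searches. Later arguments can thus cut walks freely, without tracking
    [uniq]. *)
Lemma ddist_ltP o t u v :
  reflect (exists p, [/\ path o u p, size p < t & last u p = v])
          (if ddist o u v is Some k then k < t else false).
Proof.
rewrite /ddist; apply: (iffP idP) => [|[p [op ltpt <-]]].
  set k := find _ _; case: ifP => // ltkV ltkt.
  have hasd : has (dpath o u v) (iota 0 #|V|) by rewrite has_find size_iota.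
  have := nth_find 0 hasd; rewrite -/k nth_iota // add0n.
  case/existsP=> p /and3P[op _ /eqP lastp].
  by exists p; rewrite size_tuple.
case/shortenP: op => q oq uniq_q sub_q; set k := find _ _.
have ltqV : size q < #|V|.
  by rewrite -[(size q).+1]/(size (u :: q)) -(card_uniqP uniq_q) max_card.
have dq : dpath o u (last u q) (size q).
  by apply/existsP; exists (in_tuple q); rewrite /= oq eqxx andbT.
have lekq : k <= size q.
  rewrite leqNgt; apply/negP => /(before_find 0).
  by rewrite nth_iota // add0n dq.
rewrite (leq_ltn_trans lekq ltqV).
apply: leq_ltn_trans lekq (leq_ltn_trans _ ltpt).
by apply: uniq_leq_size sub_q; case/andP: uniq_q.
Qed.

Lemma dominating1P o t S :
  reflect (forall w, exists2 s, s \in S &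
             exists p, [/\ path o s p, size p < t & last s p = w])
          (dominating o t 1 S).
Proof.
apply: (iffP forallP) => domS w; have := domS w.
  rewrite lt0n sum_nat_eq0 => /forall_inPn[s sS ds].
  exists s => //; apply/ddist_ltP; move: ds.
  by case: ddist => // k; rewrite subn_eq0 -ltnNge.
case=> s sS /ddist_ltP ds; rewrite lt0n sum_nat_eq0.
apply/forall_inPn; exists s => //; move: ds.
by case: ddist => // k; rewrite subn_eq0 -ltnNge.
Qed.

Lemma gamma1P o t : 0 < t ->
  exists2 S, dominating o t 1 S & #|S| = gamma t 1 o.
Proof.
move=> t_gt0; have domT : dominating o t 1 setT.
  by apply/dominating1P => w; exists w; [rewrite inE | exists [::]].
by rewrite /gamma; case: arg_minnP => // S domS _; exists S.
Qed.

Lemma gamma1_le o t S : 0 < t -> dominating o t 1 S -> gamma t 1 o <= #|S|.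
Proof.
move=> t_gt0 domS; have domT : dominating o t 1 setT.
  by apply/dominating1P => w; exists w; [rewrite inE | exists [::]].
by rewrite /gamma; case: arg_minnP => // S0 _; apply.
Qed.

(** Walks survive when arcs are added. This serves the end of the interpolation, where an inclusion
    of orientations replaces their equality. *)
Lemma gamma1_subrel o o' t : 0 < t -> subrel o o' ->
  gamma t 1 o' <= gamma t 1 o.
Proof.
move=> t_gt0 oo'; have [S /dominating1P domS <-] := gamma1P o t_gt0.
apply: gamma1_le => //; apply/dominating1P => w.
have [s sS [p [op ltpt lastp]]] := domS w.
by exists s => //; exists p; split=> //; apply: sub_path op.
Qed.

(** Every lost arc ends at [v], so the part of the walk after the last lost arc starts at [v] and
    survives. Only losses are constrained: the arc gained by a reversal does no harm. *)
Lemma path_lose_arcs_to o o' v s p :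
  (forall x y, o x y -> o' x y \/ y = v) -> path o s p ->
  path o' s p \/
  exists q, [/\ path o' v q, size q <= size p & last v q = last s p].
Proof.
move=> lose; elim: p s => [|y p IHp] s /=; first by left.
case/andP=> osy /IHp[o'p | [q [o'q leqp lastq]]]; last first.
  by right; exists q; split=> //; apply: leqW.
by have [-> | eyv] := lose _ _ osy; [left | right; exists p; rewrite -eyv].
Qed.

Lemma gamma1_lose_arcs_to o o' v t : 0 < t ->
  (forall x y, o x y -> o' x y \/ y = v) ->
  gamma t 1 o' <= (gamma t 1 o).+1.
Proof.
move=> t_gt0 lose; have [S /dominating1P domS <-] := gamma1P o t_gt0.
have leS : #|v |: S| <= #|S|.+1 by rewrite cardsU1 -add1n leq_add2r leq_b1.
apply: leq_trans leS; apply: gamma1_le => //; apply/dominating1P => w.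
have [s sS [p [op ltpt lastp]]] := domS w.
have [o'p | [q [o'q leqp lastq]]] := path_lose_arcs_to lose op.
  by exists s; [rewrite setU1r | exists p].
exists v; first by rewrite setU11.
by exists q; rewrite lastq; split=> //; apply: leq_ltn_trans ltpt.
Qed.

Definition reverse_arc o u v : rel V := fun x y =>
  if (x, y) == (u, v) then false else if (x, y) == (v, u) then true else o x y.

Lemma orientation_reverse_arc e o u v : symmetric e ->
  orientation e o -> o u v -> orientation e (reverse_arc o u v).
Proof.
move=> e_sym [sub_oe or_o] ouv; have euv := sub_oe _ _ ouv.
(* A loop at [u] would require [o u u (+) o u u], which is false. *)
have neq_uv : u != v by apply/eqP=> euv'; have := or_o _ _ euv; rewrite euv' addbb.
split=> x y; rewrite /reverse_arc !xpair_eqE.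
  case: ifP => // _; case: ifP => [/andP[/eqP-> /eqP->] _ | _]; last exact: sub_oe.
  by rewrite e_sym.
(* Once commuted, the tests for [(x, y)] and [(y, x)] are the same two conditions with opposite
   outcomes. *)
move/or_o; rewrite ![(y == _) && _]andbC.
case: (altP (x =P u)) => [-> | _]; case: (altP (y =P v)) => [-> | _];
  rewrite ?eqxx ?(negPf neq_uv) ?andbF //=.
all: by case: ifP.
Qed.

(** Induction on the number of arcs of [o1] absent from [o2], keeping the value at most [b]. A
    reversal may lower the value by any amount; only jumps over [b] must be excluded. *)
Lemma gamma1_interpolation e o1 o2 t b : 0 < t -> symmetric e ->
  orientation e o1 -> orientation e o2 ->
  gamma t 1 o1 <= b <= gamma t 1 o2 ->
  exists2 o, orientation e o & gamma t 1 o = b.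
Proof.
move=> t_gt0 e_sym + or2; pose diff o := [set a | o a.1 a.2 && ~~ o2 a.1 a.2].
have [n] := ubnP #|diff o1|; elim: n o1 => // n IHn o1 le_n or1.
rewrite leq_eqVlt => /andP[/orP[/eqP<- _ | lt1b leb2]]; first by exists o1.
(* With no arc left to reverse, [o1] lies inside [o2], so the value at [o2] would be below [b]. *)
have [diff0 | [[u v] uv_diff]] := set_0Vmem (diff o1).
  have sub12 : subrel o1 o2.
    move=> x y o1xy; have /setP/(_ (x, y)) := diff0.
    by rewrite !inE /= o1xy => /negbFE.
  by have := gamma1_subrel t_gt0 sub12; rewrite leqNgt (leq_trans lt1b leb2).
have /andP[/= o1uv no2uv] : o1 u v && ~~ o2 u v by move: uv_diff; rewrite inE.
have o2vu : o2 v u.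
  by have := or2.2 _ _ (or1.1 _ _ o1uv); rewrite (negPf no2uv).
apply: (IHn (reverse_arc o1 u v)); last 1 first.
(* The strict inequality [lt1b] absorbs the possible increase by 1. *)
- rewrite leb2 andbT; apply: leq_trans lt1b.
  apply: (@gamma1_lose_arcs_to _ _ v) => // x y o1xy; rewrite /reverse_arc.
  by case: eqP => [[_ ->]|_]; [right | left; case: ifP].
(* The pair [(u, v)] leaves the difference, and the new arc [(v, u)] does not enter it because [o2]
   has it. *)
- rewrite -ltnS; apply: leq_trans le_n; rewrite ltnS.
  apply: proper_card; apply/properP; split.
    apply/subsetP=> -[x y]; rewrite !inE /= /reverse_arc.
    by case: ifP => // _; case: eqP => [[-> ->]|//]; rewrite o2vu.
  by exists (u, v) => //; rewrite inE /= /reverse_arc eqxx.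
exact: orientation_reverse_arc.
Qed.

End Interpolation.

Theorem mainTheorem2 (t : nat) (t_gt0 : 0 < t)
    (V : finType) (e : rel V) (e_sym : symmetric e) (e_irr : irreflexive e)
    (d D : nat)
    (d_min : is_min_over (orientation e) (gamma t 1) d)
    (D_max : is_max_over (orientation e) (gamma t 1) D)
    (b : nat) (b_bounds : d <= b <= D) :
  exists2 o : rel V, orientation e o & gamma t 1 o = b.
Proof.
case: d_min D_max b_bounds => [[o1 or1 <-] _] [[o2 or2 <-] _].
exact: gamma1_interpolation.
Qed.
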